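(* Let $X$ be a real locally convex Hausdorff topological vector space with topological dual $Y=X^\prime$, let $C\subseteq X$ be a pointed cone, and let $\mathscr{K}\subseteq\mathcal{P}(Y)$ be a nonempty family of nonempty sets. Then $C$ is represented by $\mathscr{K}$ if and only if $\widehat{\mathscr{K}}=\mathscr{K}(C)$.
   Context: Write $\langle x,y\rangle:=y(x)$ for $x\in X$, $y\in Y=X^\prime$. A nonempty subset $C\subseteq X$ is a cone if $\lambda C\subseteq C$ for all real $\lambda>0$; it is pointed if $0\in C$. Given a nonempty family $\mathscr{K}\subseteq\mathcal{P}(Y)$ of nonempty sets, a cone $C\subseteq X$ is represented by $\mathscr{K}$ if $C=C_{\mathscr{K}}$, where $$C_{\mathscr{K}}:=\{x\in X:\ \forall K\in\mathscr{K},\ \exists y\in K,\ \langle x,y\rangle\ge 0\}.$$ For $x\in X$ let $G_x:=\{y\in Y:\langle x,y\rangle<0\}$. For a pointed cone $C$ let $\mathscr{K}(C):=\{G_x: x\in X\setminus C\}$. For a nonempty family $\mathscr{K}\subseteq\mathcal{P}(Y)$ of nonempty sets let $$\widehat{\mathscr{K}}:=\{G_x:\ x\in X,\ \exists K\in\mathscr{K},\ K\subseteq G_x\}.$$ Convention for the degenerate case: $\mathscr{K}(X)$ is understood to be $\{\emptyset\}$, and likewise $\widehat{\mathscr{K}}$ is understood to be $\{\emptyset\}$ when no $G_x$ contains a member of $\mathscr{K}$ (thus in the degenerate case both symbols denote the same family). *)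

(* Defs.v *)
From HB Require Import structures.
From mathcomp Require Import all_boot all_order all_algebra.
From mathcomp Require Import boolp classical_sets reals topology normedtype.

Set Implicit Arguments.
Unset Strict Implicit.
Unset Printing Implicit Defensive.

Import Order.TTheory GRing.Theory Num.Theory.
Import numFieldNormedType.Exports.

Local Open Scope classical_set_scope.
Local Open Scope ring_scope.

(* The topological dual X'. The library's tvsType is locally convex by
   definition, but not necessarily Hausdorff. *)
Record dual (R : realType) (X : tvsType R) := Dual {
  dual_val :> {linear X -> R^o} ;
  dual_continuous : continuous (dual_val : X -> R^o)
}.

Definition pairing (R : realType) (X : tvsType R) (x : X) (y : dual X) : R :=
  y x.

Definition is_cone (R : realType) (X : tvsType R) (C : set X) : Prop :=
  C !=set0 /\ forall l : R, 0 < l -> [set l *: x | x in C] `<=` C.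

Definition pointed_cone (R : realType) (X : tvsType R) (C : set X) : Prop :=
  is_cone C /\ C 0.

Definition cone_of (R : realType) (X : tvsType R) (F : set (set (dual X))) :
    set X :=
  [set x | forall K, F K -> exists2 y, K y & 0 <= pairing x y].

Definition represented_by (R : realType) (X : tvsType R) (C : set X)
    (F : set (set (dual X))) : Prop :=
  C = cone_of F.

(* G_x *)
Definition neg_half (R : realType) (X : tvsType R) (x : X) : set (dual X) :=
  [set y | pairing x y < 0].

(* K(C), with the convention K(X) = {set0} *)
Definition family_of (R : realType) (X : tvsType R) (C : set X) :
    set (set (dual X)) :=
  if pselect (C = [set: X]) then [set set0]
  else [set neg_half x | x in ~` C].

(* K-hat; the convention is {set0} when no G_x contains a member of F *)
Definition hat (R : realType) (X : tvsType R) (F : set (set (dual X))) :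
    set (set (dual X)) :=
  if pselect (exists x : X, exists2 K, F K & K `<=` neg_half x)
  then [set neg_half x | x in [set x | exists2 K, F K & K `<=` neg_half x]]
  else [set set0].

(* Main.v *)
Require Import Defs.
From HB Require Import structures.
From mathcomp Require Import all_boot all_order all_algebra.
From mathcomp Require Import boolp classical_sets reals topology normedtype.
From mathcomp Require Import interval_inference convex lra.

Set Implicit Arguments.
Unset Strict Implicit.
Unset Printing Implicit Defensive.

Import Order.TTheory GRing.Theory Num.Theory.
Import numFieldNormedType.Exports.

Local Open Scope classical_set_scope.
Local Open Scope ring_scope.

(** A vector x lies outside the cone represented by F exactly when some member
of F is contained in G_x, so when no family degenerates, hat F consists of the
G_x with x outside that cone, while K(C) consists of the G_x with x outside C.
The theorem therefore says that the map x |-> G_x loses no information about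
the complement of a cone. This holds because a nonempty G_x determines x up to
a positive factor: if G_x = G_z contains y0, put l = <z, y0> / <x, y0> > 0; were
z - l *: x nonzero, some functional would be nonzero on it, and correcting this
functional by a multiple of y0 would make it vanish at x but not at z, so that
one of its multiples would lie in G_z and not in G_x ([neg_half_eq_ray]).
Membership in a cone is invariant under positive factors, and the members of F
being nonempty guarantees that the relevant G_x are nonempty.

In the degenerate cases one has to know that {set0} never arises as a family of
sets G_x with x outside C: the empty set is G_x only for x = 0, which belongs to
the pointed cone C ([neg_half_nonempty]).

Both facts rest on the Hahn-Banach theorem, in the form that the dual of a
locally convex Hausdorff space separates points ([dual_separates]). Instead of
extending functionals from subspaces, the proof works with sublinear
functionals on the whole space: by Zorn's lemma there is a minimal one below
any given one, and minimal sublinear functionals are linear. Applied to the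
gauge of a convex neighborhood of 0 that misses x, this gives a functional that
is bounded above on the neighborhood, hence continuous, and nonzero at x. *)

(** * Sublinear functionals *)

(** Positive homogeneity is only required as an inequality, which is easier to
verify for infima; applying it to the inverse factor gives back the equality
([sublinearZ]). *)
Definition sublinear (R : realType) (V : lmodType R) (p : V -> R) : Prop :=
  (forall x y, p (x + y) <= p x + p y) /\
  (forall l x, 0 < l -> p (l *: x) <= l * p x).

Lemma sublinear0 (R : realType) (V : lmodType R) (p : V -> R) :
  sublinear p -> p 0 = 0.
Proof.
move=> [_ pZ]; have := pZ 2 0 ltac:(lra); have := pZ 2^-1 0 ltac:(lra).
by rewrite !scaler0; lra.
Qed.

Lemma sublinearZ (R : realType) (V : lmodType R) (p : V -> R) (l : R) (x : V) :
  sublinear p -> 0 <= l -> p (l *: x) = l * p x.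
Proof.
move=> sp; rewrite le_eqVlt => /predU1P[<-|l0].
  by rewrite scale0r mul0r sublinear0.
apply/eqP; rewrite eq_le sp.2//= -ler_pdivlMl//.
rewrite -[in leLHS](scale1r x) -(mulVf (lt0r_neq0 l0)) -scalerA.
by apply: sp.2; rewrite invr_gt0.
Qed.

(** The common source of all sublinear functionals below (shears, infima of
chains, gauges): a pointwise infimum is sublinear as soon as the sets of which
it is taken are, up to going down, compatible with sums and positive factors. *)
Lemma sublinear_inf (R : realType) (V : lmodType R) (S : V -> set R) :
  (forall x, has_inf (S x)) ->
  (forall x y a b, S x a -> S y b -> exists2 c, S (x + y) c & c <= a + b) ->
  (forall l x a, 0 < l -> S x a -> exists2 c, S (l *: x) c & c <= l * a) ->
  sublinear (fun x => inf (S x)).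
Proof.
move=> Sinf SD SZ; split=> [x y|l x l0].
  rewrite -lerBlDr; apply: lb_le_inf; first exact: (Sinf x).1.
  move=> a Sa; rewrite lerBlDr -lerBlDl.
  apply: lb_le_inf; first exact: (Sinf y).1.
  move=> b Sb; have [c Sc cab] := SD _ _ _ _ Sa Sb.
  rewrite lerBlDl; apply: le_trans cab.
  exact: ge_inf (Sinf _).2 _ Sc.
rewrite -ler_pdivrMl//; apply: lb_le_inf; first exact: (Sinf x).1.
move=> a Sa; rewrite ler_pdivrMl//.
have [c Sc cla] := SZ _ _ _ l0 Sa; apply: le_trans cla.
exact: ge_inf (Sinf _).2 _ Sc.
Qed.

(** Lowering p in the direction of y: q x is the infimum over t >= 0 of
p (x + t *: y) - t * p y. Since q (- y) <= - p y, any linear functional below q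
takes at y the value p y; and if p is minimal, q = p forces p to be additive. *)
Lemma sublinear_shear (R : realType) (V : lmodType R) (p : V -> R) (y : V) :
  sublinear p ->
  exists q : V -> R, [/\ sublinear q, (forall x, q x <= p x) &
    (forall x, q x <= p (x + y) - p y)].
Proof.
move=> sp; pose S x := [set p (x + t *: y) - t * p y | t in [set t | 0 <= t]].
have Sinf x : has_inf (S x).
  split; first by exists (p (x + 0 *: y) - 0 * p y); exists 0 => //=.
  (* t * p y = p (t *: y) <= p (x + t *: y) + p (- x) *)
  exists (- p (- x)) => _ [t /= t0 <-].
  have := sp.1 (x + t *: y) (- x).
  by rewrite addrAC subrr add0r sublinearZ//; lra.
have qle t x : 0 <= t -> inf (S x) <= p (x + t *: y) - t * p y.
  by move=> t0; apply: ge_inf; [exact: (Sinf x).2|exists t].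
exists (fun x => inf (S x)); split.
- apply: sublinear_inf => //.
    move=> x z _ _ [t /= t0 <-] [s /= s0 <-].
    exists (p (x + z + (t + s) *: y) - (t + s) * p y).
      by exists (t + s) => //=; exact: addr_ge0.
    by have := sp.1 (x + t *: y) (z + s *: y); rewrite addrACA -scalerDl; lra.
  move=> l x _ l0 [t /= t0 <-].
  exists (p (l *: x + (l * t) *: y) - l * t * p y).
    by exists (l * t) => //=; rewrite mulr_ge0// ltW.
  by have := sp.2 l (x + t *: y) l0; rewrite scalerDr scalerA; lra.
- by move=> x; have := qle 0 x (lexx _); rewrite scale0r mul0r addr0 subr0.
- by move=> x; have := qle 1 x ler01; rewrite scale1r mul1r.
Qed.

Lemma minimal_sublinear_linear (R : realType) (V : lmodType R) (q : V -> R) :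
  sublinear q ->
  (forall r : V -> R, sublinear r -> (forall x, r x <= q x) ->
    forall x, q x <= r x) ->
  linear (q : V -> R^o).
Proof.
move=> sq qmin.
have qD x y : q (x + y) = q x + q y.
  apply/eqP; rewrite eq_le sq.1/=; have [r [sr rq ry]] := sublinear_shear y sq.
  by have := qmin r sr rq x; have := ry x; lra.
have qN x : q (- x) = - q x.
  by have := qD x (- x); rewrite subrr sublinear0//; lra.
move=> a x y; rewrite qD; congr (_ + _).
have [a0|/ltW a0] := leP 0 a; first exact: sublinearZ.
by rewrite -[a]opprK scaleNr qN sublinearZ ?oppr_ge0// scaleNr.
Qed.

(** Zorn's lemma for the reversed pointwise order. The infimum of a chain is
finite because a sublinear functional below p is bounded below by - p (- x), and
it is subadditive because two members of a chain are comparable. *)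
Lemma exists_minimal_sublinear (R : realType) (V : lmodType R) (p : V -> R) :
  sublinear p ->
  exists q : V -> R, [/\ sublinear q, (forall x, q x <= p x) &
    forall r : V -> R, sublinear r -> (forall x, r x <= q x) ->
      forall x, q x <= r x].
Proof.
move=> sp; pose P (q : V -> R) := sublinear q /\ forall x, q x <= p x.
pose T := {q : V -> R | P q}.
have Pp : P p by [].
pose ge (s t : T) := `[< forall x, sval t x <= sval s x >].
have lower (t : T) x : - p (- x) <= sval t x.
  have [st tp] := svalP t; have := tp (- x); have := st.1 x (- x).
  by rewrite subrr sublinear0//; lra.
have [|||t tmin] := @ZL_preorder T (exist P p Pp) ge.
- by move=> t; apply/asboolP => x.
- move=> r s t /asboolP rs /asboolP st; apply/asboolP => x.
  exact: le_trans (st x) (rs x).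
- move=> A Atot; have [[t0 At0]|A0] := pselect (A !=set0); last first.
    by exists (exist P p Pp) => s As; case: A0; exists s.
  pose S x := [set sval t x | t in A].
  have Sinf x : has_inf (S x).
    split; first by exists (sval t0 x); exists t0.
    by exists (- p (- x)) => _ [t At <-]; exact: lower.
  have infle t x : A t -> inf (S x) <= sval t x.
    by move=> At; apply: ge_inf; [exact: (Sinf x).2|exists t].
  have sinf : sublinear (fun x => inf (S x)).
    apply: sublinear_inf => //.
      move=> x y _ _ [t At <-] [s As <-].
      have [/asboolP ts|/asboolP st] := Atot _ _ At As.
        exists (sval s (x + y)); first by exists s.
        apply: le_trans ((svalP s).1.1 x y) _.
        by rewrite lerD2r.
      exists (sval t (x + y)); first by exists t.
      by apply: le_trans ((svalP t).1.1 x y) _; rewrite lerD2l.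
    move=> l x _ l0 [t At <-]; exists (sval t (l *: x)); first by exists t.
    exact: (svalP t).1.2.
  have infp x : inf (S x) <= p x.
    exact: le_trans (infle _ _ At0) ((svalP t0).2 x).
  exists (exist P (fun x => inf (S x)) (conj sinf infp)) => s As; apply/asboolP => x /=.
  exact: infle.
- exists (sval t); split; [exact: (svalP t).1|exact: (svalP t).2|].
  move=> r sr rt.
  have rp x : r x <= p x by exact: le_trans (rt x) ((svalP t).2 x).
  suff /asboolP : ge (exist P r (conj sr rp)) t by [].
  by apply: tmin; apply/asboolP.
Qed.

(** A minimal functional below p need not touch p at x0; a minimal one below the
shear of p in the direction of x0 does. *)
Lemma hahn_banach (R : realType) (V : lmodType R) (p : V -> R) (x0 : V) :
  sublinear p ->
  exists f : {linear V -> R^o}, (forall x, f x <= p x) /\ f x0 = p x0.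
Proof.
move=> sp; have [q [sq qp qx0]] := sublinear_shear x0 sp.
have [g [sg gq gmin]] := exists_minimal_sublinear sq.
have lg := minimal_sublinear_linear sg gmin.
pose f : {linear V -> R^o} := HB.pack (g : V -> R^o)
  (GRing.isLinear.Build _ _ _ _ (g : V -> R^o) lg).
have fp x : f x <= p x by exact: le_trans (gq x) (qp x).
exists f; split=> //; apply/eqP; rewrite eq_le fp/= -lerN2.
have -> : - f x0 = g (- x0) by rewrite -[RHS]/(f (- x0)) linearN.
apply: le_trans (gq _) (le_trans (qx0 _) _).
by rewrite addNr sublinear0// sub0r.
Qed.

(** * Gauges of convex sets *)

Definition gauge (R : realType) (V : lmodType R) (U : set V) (x : V) : R :=
  inf [set t | 0 < t /\ exists2 u, U u & x = t *: u].

Section gauge.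
Variables (R : realType) (V : lmodType R) (U : set V).
Hypothesis U0 : U 0.
Hypothesis U_convex : forall u v (t : R), 0 <= t <= 1 -> U u -> U v ->
  U (t *: u + (1 - t) *: v).
Hypothesis U_absorbing : forall x, exists2 t : R, 0 < t & U (t *: x).

Let gauge_has_inf x : has_inf [set t | 0 < t /\ exists2 u, U u & x = t *: u].
Proof.
split; last by exists 0 => t [/ltW].
have [t t0 Utx] := U_absorbing x; exists t^-1; split; first by rewrite invr_gt0.
by exists (t *: x) => //; rewrite scalerA mulVf ?scale1r// lt0r_neq0.
Qed.

Lemma gauge_sublinear : sublinear (gauge U).
Proof.
apply: sublinear_inf => //.
  move=> x y a b [a0 [u Uu ->]] [b0 [v Uv ->]]; exists (a + b) => //.
  have ab0 : 0 < a + b by exact: addr_gt0.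
  split=> //; exists ((a / (a + b)) *: u + (1 - a / (a + b)) *: v).
    apply: U_convex => //; apply/andP; split; first by rewrite divr_ge0 ?ltW.
    by rewrite ler_pdivrMr// mul1r lerDl ltW.
  have abN0 := lt0r_neq0 ab0.
  rewrite scalerDr !scalerA mulrBr mulr1 !(mulrCA _ a) mulfV// mulr1.
  by rewrite [a + b]addrC addrK.
move=> l x a l0 [a0 [u Uu ->]]; exists (l * a) => //.
by split; [exact: mulr_gt0|exists u => //; rewrite scalerA].
Qed.

Lemma gauge_le1 x : U x -> gauge U x <= 1.
Proof.
move=> Ux; apply: ge_inf; first exact: (gauge_has_inf x).2.
by split=> //; exists x => //; rewrite scale1r.
Qed.

Lemma gauge_ge1 x : ~ U x -> 1 <= gauge U x.
Proof.
move=> nUx; apply: lb_le_inf; first exact: (gauge_has_inf x).1.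
move=> t [t0 [u Uu xE]]; rewrite leNgt; apply/negP => t1; apply: nUx.
rewrite xE -[_ *: u]addr0 -(scaler0 _ (1 - t)).
by apply: U_convex => //; rewrite !ltW.
Qed.

End gauge.

(** * Continuous functionals on a locally convex space *)

(** A bound from above on U bounds the absolute value on the symmetric
neighborhood W of 0 contained in U and - U, and scaling W by e makes
that bound e. *)
Lemma linear_le1_continuous (R : realType) (X : tvsType R)
    (f : {linear X -> R^o}) (U : set X) :
  nbhs 0 U -> (forall x, U x -> f x <= 1) -> continuous (f : X -> R^o).
Proof.
move=> U0 fU x; apply/cvgrPdist_le => e e0.
pose W := U `&` (-%R @` U).
have W0 : nbhs 0 W by apply: filterI => //; exact: nbhs0N.
have := nbhsT x (nbhs0Z (lt0r_neq0 e0) W0); apply: filterS.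
move=> _ [_ [w [Uw [v Uv vw]] <-] <-]; rewrite linearD linearZ/=.
rewrite opprD addNKr normrN normrM gtr0_norm// ler_piMr ?(ltW e0)//.
by rewrite ler_norml fU// andbT -vw linearN lerN2 fU.
Qed.

Lemma tvs_absorbing (R : realType) (X : tvsType R) (U : set X) (x : X) :
  nbhs 0 U -> exists2 t : R, 0 < t & U (t *: x).
Proof.
move=> U0; have := @scale_continuous R X (0, x) U.
rewrite /= scale0r => /(_ U0)[[A B] /= [A0 Bx] ABU].
have [e /= e0 eA] := A0.
exists (e / 2); first by rewrite divr_gt0.
apply: (ABU (e / 2, x)); split => /=; last exact: nbhs_singleton.
apply: eA => /=; rewrite sub0r normrN gtr0_norm ?divr_gt0//.
by rewrite ltr_pdivrMr// ltr_pMr// ltr1n.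
Qed.

(** The functional comes from the gauge of a convex neighborhood U of 0 that does
not contain x: it is at most 1 on U, hence continuous, and at least 1 at x. *)
Lemma dual_separates (R : realType) (X : tvsType R) (x : X) :
  hausdorff_space X -> x != 0 -> exists y : dual X, pairing x y != 0.
Proof.
move=> hX x0; have [B Bconv [Bopen Bnbhs]] := @locally_convex R X.
have [V [oV V0 Vx]] : exists V : set X, [/\ open V, V 0 & ~ V x].
  have [|V [oV V0 Vx]] := hausdorff_accessible hX (x := 0) (y := x).
    by rewrite eq_sym.
  by exists V; split=> //; [exact: set_mem|exact: set_mem Vx].
have [U [BU U0] UV] := Bnbhs 0 V (open_nbhs_nbhs (conj oV V0)).
have nU : nbhs 0 U by apply: open_nbhs_nbhs; split=> //; exact: Bopen.
have Uconv u v (t : R) : 0 <= t <= 1 -> U u -> U v -> U (t *: u + (1 - t) *: v).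
  move=> /andP[t0 t1] Uu Uv; apply/set_mem.
  exact: (Bconv U (mem_set BU) u v (Itv01 t0 t1) (mem_set Uu) (mem_set Uv)).
have Uabs z : exists2 t : R, 0 < t & U (t *: z) by exact: tvs_absorbing.
have [f [fU fx]] := hahn_banach x (gauge_sublinear Uconv Uabs).
have fcont : continuous (f : X -> R^o).
  apply: (linear_le1_continuous nU) => z Uz.
  exact: le_trans (fU z) (gauge_le1 Uabs Uz).
exists (Dual fcont); rewrite /pairing/= fx lt0r_neq0//.
apply: lt_le_trans ltr01 (gauge_ge1 U0 Uconv Uabs _).
by move=> Ux; apply: Vx; exact: UV.
Qed.

(** * The sets G_x *)

Lemma dual_addZ (R : realType) (X : tvsType R) (y1 y2 : dual X) (a : R) :
  exists y : dual X, forall x, pairing x y = a * pairing x y1 + pairing x y2.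
Proof.
pose g (x : X) : R^o := a *: (y1 x : R^o) + y2 x.
have lg : linear g.
  by move=> k u v; rewrite /g !linearP/= /GRing.scale/=; lra.
pose f : {linear X -> R^o} := HB.pack g (GRing.isLinear.Build _ _ _ _ g lg).
have fcont : continuous (f : X -> R^o).
  move=> x; apply: cvgD; last exact: dual_continuous.
  by apply: cvgZr; exact: dual_continuous.
by exists (Dual fcont).
Qed.

Lemma dual_scale (R : realType) (X : tvsType R) (y : dual X) (a : R) :
  exists y' : dual X, forall x, pairing x y' = a * pairing x y.
Proof.
have [y' y'E] := dual_addZ y y (a - 1).
by exists y' => x; rewrite y'E mulrBl mul1r subrK.
Qed.

Lemma neg_half_nonempty (R : realType) (X : tvsType R) (x : X) :
  hausdorff_space X -> x != 0 -> neg_half x !=set0.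
Proof.
move=> hX /(dual_separates hX)[y xy].
have [y' y'E] := dual_scale y (- (pairing x y)^-1).
by exists y'; rewrite /neg_half/= y'E mulNr mulVf ?ltrN10.
Qed.

(** The set G_x, when nonempty, determines the open ray through x. *)
Lemma neg_half_eq_ray (R : realType) (X : tvsType R) (x z : X) :
  hausdorff_space X -> neg_half x !=set0 -> neg_half x = neg_half z ->
  exists2 l : R, 0 < l & z = l *: x.
Proof.
move=> hX [y0 y0x] Gxz; have y0z : neg_half z y0 by rewrite -Gxz.
rewrite /neg_half/= in y0x y0z.
pose l := pairing z y0 / pairing x y0.
have l0 : 0 < l by rewrite ltr_ndivlMr// mul0r.
exists l => //; apply/eqP; rewrite -subr_eq0; apply/negPn/negP => w0.
have [y yw] := dual_separates hX w0.
have yD a u v k : pairing (u - k *: v) a = pairing u a - k * pairing v a.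
  by move=> *; rewrite /pairing linearB linearZ.
(* v vanishes at x; since y0 vanishes at z - l *: x, v agrees there with y, and
   so v is nonzero at z. *)
have [v vE] := dual_addZ y0 y (- (pairing x y / pairing x y0)).
have vx : pairing x v = 0.
  by rewrite vE mulNr divfK ?ltr0_neq0// addNr.
have vz : pairing z v != 0.
  rewrite vE -[pairing z y](subrK (l * pairing x y)) -yD.
  rewrite addrCA mulNr mulrAC -mulrA -/l [_ * l]mulrC addNr addr0//.
have [v' v'E] := dual_scale v (- (pairing z v)^-1).
have : neg_half z v' by rewrite /neg_half/= v'E mulNr mulVf ?ltrN10.
by rewrite -Gxz /neg_half/= v'E vx mulr0 ltxx.
Qed.

(** * Cones and their families *)

Lemma notin_cone_of (R : realType) (X : tvsType R) (F : set (set (dual X)))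
    (x : X) :
  ~ cone_of F x <-> exists2 K, F K & K `<=` neg_half x.
Proof.
split=> [/existsNP[K /not_implyP[FK nK]]|[K FK Kx] /(_ K FK)[y /Kx]].
  exists K => // y Ky; rewrite /neg_half/= ltNge; apply/negP => xy.
  by apply: nK; exists y.
by rewrite /neg_half/= ltNge => /negP.
Qed.

Theorem theorem2p5 (R : realType) (X : tvsType R)
    (X_hausdorff : hausdorff_space X)
    (C : set X) (C_cone : pointed_cone C)
    (F : set (set (dual X))) (F_neq0 : F !=set0)
    (F_mem_neq0 : forall K, F K -> K !=set0) :
  represented_by C F <-> hat F = family_of C.
Proof.
rewrite /represented_by /hat /family_of.
have -> : [set x : X | exists2 K, F K & K `<=` neg_half x] = ~` cone_of F.
  by apply/seteqP; split=> x; [move=> Kx; apply/notin_cone_of|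
    move=> Fx; apply/notin_cone_of].
have [[_ CZ] C0] := C_cone.
split=> [->|].
  case: pselect => [[x Kx]|noF].
    have nFx : ~ cone_of F x by apply/notin_cone_of.
    by case: pselect => // FT; rewrite FT in nFx; case: nFx.
  case: pselect => // FT; exfalso; apply: FT; apply/seteqP; split=> // x _.
  by apply: contrapT => /notin_cone_of nFx; apply: noF; exists x.
case: pselect => [[x0 Kx0]|noF]; case: pselect => [CT|CnT] /= hatE.
(* Here C is the whole space, so G_(x0) is empty, yet contains a member of F. *)
- have x0F : [set neg_half x | x in ~` cone_of F] (neg_half x0).
    by exists x0 => //; apply/notin_cone_of.
  have [K /F_mem_neq0[y Ky] /(_ y Ky)] := Kx0.
  by move: x0F; rewrite hatE => /= ->.
- suff CE x : ~ C x <-> ~ cone_of F x.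
    by apply/seteqP; split=> x; apply: contraPP => /CE.
  split=> [nCx|nFx].
    have : [set neg_half x | x in ~` C] (neg_half x) by exists x.
    by rewrite -hatE => -[z /notin_cone_of Kz Gzx]; apply/notin_cone_of;
      rewrite -Gzx.
  have : [set neg_half x | x in ~` cone_of F] (neg_half x) by exists x.
  rewrite hatE => -[z nCz Gzx] Cx; apply: nCz.
  have [|l l0 ->] := neg_half_eq_ray X_hausdorff _ (esym Gzx).
    have [K /F_mem_neq0[y Ky] Kx] := (notin_cone_of F x).1 nFx.
    by exists y; exact: Kx.
  by apply: (CZ l l0); exists x.
(* Both families are degenerate, and both cones are the whole space. *)
- rewrite CT; apply/seteqP; split=> // x _; apply: contrapT => nFx.
  by apply: noF; exists x; apply/notin_cone_of.
(* Some x outside C would have G_x empty, hence x = 0, which belongs to C. *)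
- exfalso; apply: CnT; apply/seteqP; split=> // x _; apply: contrapT => nCx.
  have : [set neg_half x | x in ~` C] (neg_half x) by exists x.
  rewrite -hatE => /= Gx0.
  have [|y] := neg_half_nonempty (x := x) X_hausdorff; last by rewrite Gx0.
  by apply/eqP => x0; apply: nCx; rewrite x0.
Qed.
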